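(* Let $\mathcal H$ be a Hilbert space, let $\mathcal C$ be a family of closed subspaces of $\mathcal H$ containing the zero subspace and having the Minimal Approximation Property, let $1\le l\le m$ be integers, and let $\mathcal F=\{f_1,\dots,f_m\}$ be a set of vectors in $\mathcal H$. Let $G:\Pi_l\to\mathfrak B$ and $H:\mathfrak B\to\Pi_l$ be any choice functions with $G(P)\in\mathcal W(P)$ for every $P\in\Pi_l$ and $H(\mathbf V)\in\Omega_l(\mathbf V)$ for every $\mathbf V\in\mathfrak B$. Consider the following algorithm: (1) Pick any partition $P_1\in\Pi_l$, set $\mathbf V_{P_1}=G(P_1)$ and $j=1$. (2) While $\Gamma(P_j,\mathbf V_{P_j})>e(\mathcal F,\mathbf V_{P_j})$: set $P_{j+1}=H(\mathbf V_{P_j})$, set $\mathbf V_{P_{j+1}}=G(P_{j+1})$, and increase $j$ by $1$. Then, for every choice of the initial partition $P_1$, the algorithm terminates in finitely many steps.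
   Context: For $x,y\in\mathcal H$, $d(x,y)=\|x-y\|_{\mathcal H}$, and $d(f,V)=\inf_{v\in V}d(f,v)$ for a closed subspace $V$. For a finite set $\mathcal G\subset\mathcal H$ and a closed subspace $V$, $E(\mathcal G,V)=\sum_{f\in\mathcal G}d^2(f,V)$, with $E(\emptyset,V)=0$. $\mathcal C$ has the Minimal Approximation Property (MAP) if for every finite set $\mathcal G\subset\mathcal H$ there is $V_0\in\mathcal C$ with $E(\mathcal G,V_0)\le E(\mathcal G,V)$ for all $V\in\mathcal C$. Any such $V_0$ is called an optimal subspace for $\mathcal G$ (so every $V\in\mathcal C$ is optimal for $\mathcal G=\emptyset$). $\mathfrak B=\mathfrak B(l)$ is the set of all sequences (called bundles) $\mathbf V=\{V_1,\dots,V_l\}$ of length $l$ with $V_i\in\mathcal C$ for all $i$ (repetitions allowed). For $\mathbf V=\{V_1,\dots,V_l\}\in\mathfrak B$, $$e(\mathcal F,\mathbf V)=\sum_{f\in\mathcal F}\min_{1\le j\le l}d^2(f,V_j).$$ $\Pi_l$ is the set of all $l$-sequences $P=\{\mathcal F_1,\dots,\mathcal F_l\}$ of subsets of $\mathcal F$ (possibly empty), pairwise disjoint for distinct indices, with $\mathcal F=\bigcup_{s=1}^l\mathcal F_s$; its elements are called partitions. For $P=\{\mathcal F_1,\dots,\mathcal F_l\}\in\Pi_l$ and $\mathbf V=\{V_1,\dots,V_l\}\in\mathfrak B$, $$\Gamma(P,\mathbf V)=\sum_{i=1}^lE(\mathcal F_i,V_i).$$ For $P=\{\mathcal F_1,\dots,\mathcal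 F_l\}\in\Pi_l$, $\mathcal W(P)\subset\mathfrak B$ is the set of bundles $\{V_1,\dots,V_l\}\in\mathfrak B$ such that $V_i$ is an optimal subspace for $\mathcal F_i$ for each $i=1,\dots,l$. For $\mathbf V=\{V_1,\dots,V_l\}\in\mathfrak B$, $\Omega_l(\mathbf V)\subset\Pi_l$ is the set of partitions $P=\{\mathcal F_1,\dots,\mathcal F_l\}\in\Pi_l$ such that $f\in\mathcal F_j$ implies $d(f,V_j)\le d(f,V_h)$ for all $h=1,\dots,l$. *)

(* Defs.v *)
From HB Require Import structures.
From mathcomp Require Import all_boot all_order all_algebra.
From mathcomp Require Import finmap complex.
From mathcomp Require Import all_classical all_reals all_analysis.
Import Order.TTheory GRing.Theory Num.Theory.
Import numFieldNormedType.Exports.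

Set Implicit Arguments.
Unset Strict Implicit.
Unset Printing Implicit Defensive.

Local Open Scope classical_set_scope.
Local Open Scope ring_scope.

(* Hilbert spaces over both the real and the complex numbers are covered. *)
Variant scalar_kind := RealScalars | ComplexScalars.

Definition hilbert_scalar (R : realType) (k : scalar_kind) : numFieldType :=
  match k with
  | RealScalars => R
  | ComplexScalars => (R[i])%C
  end.

Definition scalar_conj (R : realType) (k : scalar_kind) :
    hilbert_scalar R k -> hilbert_scalar R k :=
  match k with
  | RealScalars => fun x => x
  | ComplexScalars => @conjc R
  end.

Definition scalar_re (R : realType) (k : scalar_kind) : hilbert_scalar R k -> R :=
  match k with
  | RealScalars => fun x => x
  | ComplexScalars => @complex.Re R
  end.

(* The minimum of a family indexed by 'I_l. The starting value is the first
   member of the family, so this is the true minimum as soon as 0 < l. *)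
Definition min_ord (R : realType) (l : nat) (a : 'I_l -> R) : R :=
  \big[Num.min/head 0 (codom a)]_(j < l) a j.

Section Bundles.
Variables (R : realType) (k : scalar_kind).
Variable H : completeNormedModType (hilbert_scalar R k).

(* A complete normed space is a Hilbert space when its norm comes from an inner
   product, which is linear in its first argument. *)
Definition induces_norm (ip : {dot H for @scalar_conj R k}) : Prop :=
  forall x : H, `|x| ^+ 2 = ip x x.

(* The library norm takes its values in the scalar field; it is read in R. *)
Definition hdist (x y : H) : R := scalar_re `|x - y|.

Definition closed_subspace (V : set H) : Prop :=
  [/\ V 0,
      forall (a : hilbert_scalar R k) (x y : H), V x -> V y -> V (a *: x + y)
    & closed V].

Definition hdist_to (f : H) (V : set H) : R := inf [set hdist f v | v in V].

Definition approx_error (G : {fset H}) (V : set H) : R :=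
  \sum_(f <- G) hdist_to f V ^+ 2.

Section Family.
Variable C : set (set H).

Definition optimal (G : {fset H}) (V0 : set H) : Prop :=
  C V0 /\ forall V, C V -> approx_error G V0 <= approx_error G V.

Definition MAP : Prop := forall G : {fset H}, exists V0, optimal G V0.

Definition bundles (l : nat) : set ('I_l -> set H) :=
  [set V | forall i, C (V i)].

Definition optimal_bundles (l : nat) (P : 'I_l -> {fset H}) :
    set ('I_l -> set H) :=
  [set V | bundles V /\ forall i, optimal (P i) (V i)].

End Family.

Definition bundle_error (l : nat) (F : {fset H}) (V : 'I_l -> set H) : R :=
  \sum_(f <- F) min_ord (fun j => hdist_to f (V j) ^+ 2).

Definition partitions (l : nat) (F : {fset H}) : set ('I_l -> {fset H}) :=
  [set P | [/\ forall i, (P i `<=` F)%fset,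
               forall i j, i != j -> [disjoint P i & P j]%fset
             & F = (\bigcup_(i in 'I_l) P i)%fset]].

Definition Gamma (l : nat) (P : 'I_l -> {fset H}) (V : 'I_l -> set H) : R :=
  \sum_(i < l) approx_error (P i) (V i).

Definition best_partitions (l : nat) (F : {fset H}) (V : 'I_l -> set H) :
    set ('I_l -> {fset H}) :=
  [set P | partitions F P /\
     forall f j, f \in P j -> forall h, hdist_to f (V j) <= hdist_to f (V h)].

(* [algorithm_state F g h P1 j P V]: started from the partition P1, the
   algorithm reaches the test of the while loop with counter j, current
   partition P_j = P and current bundle V_{P_j} = V. *)
Inductive algorithm_state (l : nat) (F : {fset H})
    (g : ('I_l -> {fset H}) -> ('I_l -> set H))
    (h : ('I_l -> set H) -> ('I_l -> {fset H})) (P1 : 'I_l -> {fset H}) :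
    nat -> ('I_l -> {fset H}) -> ('I_l -> set H) -> Prop :=
| algorithm_init : algorithm_state F g h P1 1 P1 (g P1)
| algorithm_loop (j : nat) (P : 'I_l -> {fset H}) (V : 'I_l -> set H) :
    algorithm_state F g h P1 j P V ->
    Gamma P V > bundle_error F V ->
    algorithm_state F g h P1 j.+1 (h V) (g (h V)).

(* The run is deterministic, so it is finite exactly when it reaches a state
   in which the loop condition fails. *)
Definition algorithm_terminates (l : nat) (F : {fset H})
    (g : ('I_l -> {fset H}) -> ('I_l -> set H))
    (h : ('I_l -> set H) -> ('I_l -> {fset H})) (P1 : 'I_l -> {fset H}) :
    Prop :=
  exists (j : nat) (P : 'I_l -> {fset H}) (V : 'I_l -> set H),
    algorithm_state F g h P1 j P V /\ ~ (Gamma P V > bundle_error F V).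

End Bundles.

(* Main.v *)
Require Import Defs.
From HB Require Import structures.
From mathcomp Require Import all_boot all_order all_algebra.
From mathcomp Require Import finmap complex.
From mathcomp Require Import all_classical all_reals all_analysis.
Import Order.TTheory GRing.Theory Num.Theory.
Import numFieldNormedType.Exports.

Set Implicit Arguments.
Unset Strict Implicit.
Unset Printing Implicit Defensive.

Local Open Scope classical_set_scope.
Local Open Scope ring_scope.

(** Reassigning every vector to a nearest subspace turns Gamma into the bundle
    error, and replacing each subspace by an optimal one does not increase
    Gamma. So whenever the loop condition holds, one pass of the loop strictly
    decreases Gamma (P, G (P)), a quantity that depends on P only and hence
    takes finitely many values. *)

Lemma min_ord_eq (R : realType) (l : nat) (a : 'I_l -> R) (j : 'I_l) :
  (forall i, a j <= a i) -> min_ord a = a j.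
Proof.
move=> a_min; apply/eqP; rewrite eq_le; apply/andP; split.
  exact: bigmin_le.
apply: le_bigmin => //.
(* The starting value of the fold is itself a value of [a]: the index [j] makes [codom a] nonempty,
   so the default 0 of [head] is never taken. *)
have : head 0 (codom a) \in codom a.
  have : a j \in codom a by exact: codom_f.
  by case: (codom a) => //= x s _; rewrite mem_head.
by case/codomP => i ->.
Qed.

Lemma scalar_re_ge0 (R : realType) (k : scalar_kind) (x : hilbert_scalar R k) :
  0 <= x -> 0 <= scalar_re x.
Proof. by case: k x => //= x; rewrite lecE => /andP[]. Qed.

Lemma hdist_to_ge0 (R : realType) (k : scalar_kind)
    (H : completeNormedModType (hilbert_scalar R k)) (x : H) (V : set H) :
  0 <= hdist_to x V.
Proof.
(* [V] is an arbitrary set, so the set of distances may be empty; its [inf] is then 0 by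
   convention. *)
rewrite /hdist_to; have [->|] := eqVneq [set hdist x v | v in V] set0.
  by rewrite inf0.
move=> /set0P dist_neq0; apply: lb_le_inf => // _ [v _ <-].
exact: scalar_re_ge0.
Qed.

Lemma big_partition_ord (T : choiceType) (R : Type) (idx : R)
    (op : Monoid.com_law idx) (l : nat) (P : 'I_l -> {fset T}) (a : T -> R) :
  (forall i j, i != j -> [disjoint P i & P j]%fset) ->
  \big[op/idx]_(x <- (\bigcup_(i in 'I_l) P i)%fset) a x =
  \big[op/idx]_(i < l) \big[op/idx]_(x <- P i) a x.
Proof.
(* [partition_disjoint_bigfcup] sums over a finite set of indices, so [K] stands in for the
   enumeration of ['I_l] on both sides. *)
move=> P_disj; pose K := [fset i in 'I_l]%fset.
have perm_K : perm_eq (index_enum 'I_l) K.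
  apply: uniq_perm; rewrite ?index_enum_uniq ?fset_uniq // => i.
  by rewrite mem_index_enum !inE.
rewrite [RHS](perm_big _ perm_K) /= -partition_disjoint_bigfcup; last first.
  by move=> i j _ _; exact: P_disj.
by rewrite (perm_big _ perm_K).
Qed.

(** Induction on the number of codes [t] with [phi (d t) < phi a]. Passing to a [b] of smaller [phi]
    only removes codes, and it does remove the code of [b] itself. *)
Lemma finite_descent (T : finType) (A : Type) (R : realType) (d : T -> A)
    (phi : A -> R) (S Q : A -> Prop) :
  (forall a, S a -> exists t, a = d t) ->
  (forall a, S a -> Q a \/ exists2 b, S b & phi b < phi a) ->
  forall a, S a -> exists2 b, S b & Q b.
Proof.
move=> S_fin step a.
have [n] := ubnP #|[pred t | phi (d t) < phi a]|.
elim: n a => // n IHn a; rewrite ltnS => le_n Sa.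
have [Qa|[b Sb lt_ba]] := step a Sa; first by exists a.
apply: (IHn b) => //; apply: leq_trans le_n; apply: proper_card.
have [t b_t] := S_fin b Sb.
apply/properP; split.
  by apply/fintype.subsetP => s; rewrite !inE => /lt_trans; apply.
by exists t; rewrite !inE -b_t // ltxx.
Qed.

Section Descent.
Variables (R : realType) (k : scalar_kind).
Variables (H : completeNormedModType (hilbert_scalar R k)).
Variables (C : set (set H)) (l : nat) (F : {fset H}).

(** Provides the finite type of codes for the descent: the blocks lie in the power set of [F],
    although [{fset H}] may be infinite. *)
Lemma partition_of_ffun (P : 'I_l -> {fset H}) :
  partitions F P ->
  exists t : {ffun 'I_l -> fpowerset F}, P = fun i => val (t i).
Proof.
case=> P_sub _ _.
have P_pow i : P i \in fpowerset F by rewrite fpowersetE.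
exists [ffun i => [` P_pow i]%fset]; apply/funext => i.
by rewrite ffunE.
Qed.

(** Disjoint blocks count each vector of [F] once, and for a vector of block [i] the minimum over
    all subspaces is attained at index [i]. *)
Lemma Gamma_best_partition (V : 'I_l -> set H) (P : 'I_l -> {fset H}) :
  best_partitions F V P -> Gamma P V = bundle_error F V.
Proof.
case=> -[_ P_disj F_cover] P_best.
rewrite /bundle_error [in RHS]F_cover big_partition_ord //.
apply: eq_bigr => i _; apply: eq_big_seq => x x_Pi.
rewrite (@min_ord_eq _ _ _ i) // => j.
by rewrite lerXn2r ?nnegrE ?hdist_to_ge0 // P_best.
Qed.

Lemma Gamma_optimal (P : 'I_l -> {fset H}) (V W : 'I_l -> set H) :
  optimal_bundles C P V -> bundles C W -> Gamma P V <= Gamma P W.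
Proof.
by move=> [_ V_opt] W_C; apply: ler_sum => i _; apply: (V_opt i).2.
Qed.

End Descent.

Theorem mainTheorem4 (R : realType) (k : scalar_kind)
    (H : completeNormedModType (hilbert_scalar R k))
    (ip : {dot H for @scalar_conj R k}) (ip_norm : induces_norm ip)
    (C : set (set H))
    (C_closed : forall V : set H, C V -> closed_subspace V)
    (C_zero : C [set 0])
    (C_MAP : MAP C)
    (l m : nat) (l_ge1 : (1 <= l)%N) (l_le_m : (l <= m)%N)
    (f : 'I_m -> H) (F : {fset H}) (F_def : F = [fset f i | i in 'I_m]%fset)
    (g : ('I_l -> {fset H}) -> ('I_l -> set H))
    (h : ('I_l -> set H) -> ('I_l -> {fset H}))
    (g_optimal : forall P : 'I_l -> {fset H},
        partitions F P -> optimal_bundles C P (g P))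
    (h_best : forall V : 'I_l -> set H,
        bundles C V -> best_partitions F V (h V)) :
  forall P1 : 'I_l -> {fset H},
    partitions F P1 -> algorithm_terminates F g h P1.
Proof.
move=> P1 P1_part.
(* The bundle of a state is always [g P], so states are tracked by their partition alone and the
   counter is hidden. *)
pose reached P := partitions F P /\ exists j, algorithm_state F g h P1 j P (g P).
pose halts P := ~ (Gamma P (g P) > bundle_error F (g P)).
have reached1 : reached P1 by split=> //; exists 1%N; exact: algorithm_init.
have reached_fin P : reached P ->
    exists t : {ffun 'I_l -> fpowerset F}, P = fun i => val (t i).
  by move=> [P_part _]; exact: partition_of_ffun.
have step P : reached P ->
    halts P \/ exists2 P', reached P' & Gamma P' (g P') < Gamma P (g P).
  move=> [P_part [j P_state]]; rewrite /halts.
  have [gt_e|] := pselect (Gamma P (g P) > bundle_error F (g P)); last by left.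
  right; have gP_C : bundles C (g P) by have [] := g_optimal _ P_part.
  have hP_best := h_best _ gP_C; have [hP_part _] := hP_best.
  exists (h (g P)).
    by split=> //; exists j.+1; exact: algorithm_loop P_state gt_e.
  (* The intermediate value is [Gamma (h (g P)) (g P)], the new partition with the old bundle. *)
  apply: le_lt_trans gt_e; rewrite -(Gamma_best_partition hP_best).
  exact: Gamma_optimal (g_optimal _ hP_part) gP_C.
have [P [_ [j P_state]] P_halts] := finite_descent reached_fin step reached1.
by exists j, P, (g P).
Qed.
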